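(* For every integer $q\ge 1$ we have $\gamma^{SLD}(K_q^3)=q^2$.
   Context: $K_q^3=K_q\square K_q\square K_q$ is the graph with vertex set $V=\{(x,y,z)\in\mathbb{Z}^3\mid 1\le x,y,z\le q\}$ in which two distinct vertices are adjacent iff they differ in exactly one coordinate. $N[v]$ denotes the closed neighbourhood of $v$. A code is a nonempty subset $C\subseteq V$, and $I(u)=N[u]\cap C$. A code $C$ is self-locating-dominating in a graph $G$ with vertex set $V$ if for each $u\in V\setminus C$ we have $I(u)\neq\emptyset$ and $\bigcap_{c\in I(u)}N[c]=\{u\}$. $\gamma^{SLD}(G)$ is the minimum cardinality of a self-locating-dominating code in the finite graph $G$. *)

(* Defs.v *)
From mathcomp Require Import all_boot.

Set Implicit Arguments.
Unset Strict Implicit.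
Unset Printing Implicit Defensive.

(* A finite simple graph is given by an adjacency relation e on a finType T,
   assumed symmetric and irreflexive. *)

Section Codes.
Variables (T : finType) (e : rel T).
Implicit Types (C : {set T}) (u v : T).

Definition closed_nbh v : {set T} := [set u | (u == v) || e v u].

Definition I_set C u : {set T} := closed_nbh u :&: C.

Definition self_locating_dominating C : bool :=
  (C != set0) &&
  [forall u, (u \notin C) ==>
     (I_set C u != set0) &&
     (\bigcap_(c in I_set C u) closed_nbh c == [set u])].

(* The set of all vertices is only the starting point of the search for a
   minimum; it is itself a code when T is nonempty (see gamma_SLDP). For an
   empty T there is no code and the value is 0. *)
Definition gamma_SLD : nat :=
  #|[arg min_(C < [set: T] | self_locating_dominating C) #|C|]|.

Lemma gamma_SLDP : 0 < #|T| ->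
  (exists2 C, self_locating_dominating C & #|C| = gamma_SLD) /\
  (forall C, self_locating_dominating C -> gamma_SLD <= #|C|).
Proof.
move=> T_gt0; rewrite /gamma_SLD; case: arg_minnP => [|C codeC minC].
  rewrite /self_locating_dominating -card_gt0 cardsT T_gt0 /=.
  by apply/forallP=> u; rewrite in_setT.
by split; first by exists C.
Qed.

End Codes.

(* K_q [] K_q [] K_q; the coordinates are 0, ..., q - 1 instead of 1, ..., q. *)
Definition K3_vertex (q : nat) : finType := ('I_q * 'I_q * 'I_q)%type.

(* The booleans are counted as 0 or 1. *)
Definition K3_adj (q : nat) : rel (K3_vertex q) :=
  fun u v => let: (x, y, z) := u in let: (x', y', z') := v in
    (x != x') + (y != y') + (z != z') == 1.

Lemma K3_adj_sym q : symmetric (@K3_adj q).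
Proof.
move=> [[x y] z] [[x' y'] z'] /=.
by rewrite (eq_sym x) (eq_sym y) (eq_sym z).
Qed.

Lemma K3_adj_irr q : irreflexive (@K3_adj q).
Proof. by move=> [[x y] z] /=; rewrite !eqxx. Qed.

(* Main.v *)
Require Import Defs.
From mathcomp Require Import all_boot.
From mathcomp Require Import ssralg zmodp.

(** Lower bound: a vertex u outside a self-locating-dominating code C has at
    least three codewords around it ([three_codewords]), because the closed
    neighbourhoods of at most two neighbours of u always share a second vertex
    ([common_neighbour]). Each codeword has at most 3(q - 1) neighbours
    ([K3_degree]), so counting the adjacent pairs between C and its complement
    ([double_counting]) gives 3(q^3 - |C|) <= 3(q - 1)|C|, which simplifies to
    q^2 <= |C|.

    Upper bound: the graph of a Latin square, here the plane x + y + z = 0 over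
    the integers modulo q, has q^2 points and meets every axis-parallel line
    exactly once. A vertex u outside it therefore sees one codeword in each of
    the three directions, and these three already locate u
    ([three_directions_locate]). *)

Set Implicit Arguments.
Unset Strict Implicit.
Unset Printing Implicit Defensive.

(** Count the pairs of adjacent vertices (u, c) with c in C and u outside C, once
    by u and once by c; for such u, I_set consists of neighbours only. *)
Lemma double_counting (T : finType) (e : rel T) (C : {set T}) (k d : nat) :
    symmetric e ->
    (forall u, u \notin C -> k <= #|I_set e C u|) ->
    (forall c, c \in C -> #|[set u | e c u]| <= d) ->
  k * (#|T| - #|C|) <= d * #|C|.
Proof.
move=> e_sym kI degd.
have -> : #|T| - #|C| = #|~: C| by rewrite -(cardsC C) addKn.
apply: (@leq_trans (\sum_(u in ~: C) \sum_(c in C) e c u)).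
  rewrite mulnC -sum_nat_const; apply: leq_sum => u; rewrite inE => uC.
  apply: leq_trans (kI u uC) _.
  rewrite -sum1_card [leqRHS]big_mkcond [leqLHS]big_mkcond; apply: leq_sum => c _.
  rewrite !inE e_sym; case: eqP => [->|_] /=; first by rewrite (negPf uC).
  by case: (c \in C); case: (e c u).
rewrite exchange_big mulnC -sum_nat_const; apply: leq_sum => c cC.
apply: leq_trans (degd c cC).
rewrite -sum1_card [leqRHS]big_mkcond [leqLHS]big_mkcond; apply: leq_sum => u _.
by rewrite inE; case: (u \in ~: C); case: (e c u).
Qed.

(** The neighbours of v form three axis-parallel lines punctured at v. *)
Lemma K3_degree q (v : K3_vertex q) : #|[set u | K3_adj v u]| <= 3 * (q - 1).
Proof.
case: v => [[x y] z].
pose X := [set (x', y, z) | x' in [set~ x]].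
pose Y := [set (x, y', z) | y' in [set~ y]].
pose Z := [set (x, y, z') | z' in [set~ z]].
have sub : [set u | K3_adj ((x, y, z) : K3_vertex q) u] \subset X :|: Y :|: Z.
  apply/subsetP=> -[[x' y'] z']; rewrite !inE /=.
  case: (eqVneq x x') => [<-|nx]; case: (eqVneq y y') => [<-|ny];
    case: (eqVneq z z') => [<-|nz] //= _.
  - by apply/orP; right; apply/imsetP; exists z'; rewrite // !inE eq_sym.
  - by apply/orP; left; apply/orP; right; apply/imsetP; exists y';
      rewrite // !inE eq_sym.
  - by apply/orP; left; apply/orP; left; apply/imsetP; exists x';
      rewrite // !inE eq_sym.
have punctured (t : 'I_q) (f : 'I_q -> K3_vertex q) :
    #|[set f i | i in [set~ t]]| <= q - 1.
  by rewrite (leq_trans (leq_imset_card _ _)) // cardsC1 card_ord subn1.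
apply: leq_trans (subset_leq_card sub) _.
apply: leq_trans (leq_card_setU _ _) _.
rewrite !mulSn mul0n addn0 addnA; apply: leq_add; last exact: punctured.
apply: leq_trans (leq_card_setU _ _) _.
by apply: leq_add; exact: punctured.
Qed.

(** This is why two codewords cannot locate u. The witness takes each coordinate
    from c1 where c1 departs from u, and from c2 elsewhere: it is the fourth
    corner of the rectangle u, c1, c2 when c1 and c2 lie in different directions
    from u, and c1 itself when all three share a line. *)
Lemma common_neighbour q (u c1 c2 : K3_vertex q) :
    K3_adj u c1 -> K3_adj u c2 ->
  exists w, [/\ w != u, w \in closed_nbh (@K3_adj q) c1
                     & w \in closed_nbh (@K3_adj q) c2].
Proof.
move: u c1 c2 => [[x y] z] [[x1 y1] z1] [[x2 y2] z2] /= adj1 adj2.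
exists (if x == x1 then x2 else x1, if y == y1 then y2 else y1,
        if z == z1 then z2 else z1).
rewrite !inE /= !xpair_eqE; move: adj1 adj2.
case: (eqVneq x x1) => [<-|nx1]; case: (eqVneq y y1) => [<-|ny1];
  case: (eqVneq z z1) => [<-|nz1] //= _;
  case: (eqVneq x x2) => [<-|nx2]; case: (eqVneq y y2) => [<-|ny2];
  case: (eqVneq z z2) => [<-|nz2] //= _;
  rewrite ?eqxx ?(eq_sym x1 x) ?(eq_sym y1 y) ?(eq_sym z1 z)
          ?(eq_sym x2 x) ?(eq_sym y2 y) ?(eq_sym z2 z)
          ?(negPf nx1) ?(negPf ny1) ?(negPf nz1)
          ?(negPf nx2) ?(negPf ny2) ?(negPf nz2) ?(eq_sym x2 x1)
          ?(eq_sym y2 y1) ?(eq_sym z2 z1) ?eqxx //=.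
- by case: (z1 == z2).
- by case: (y1 == y2).
- by case: (x1 == x2).
Qed.

Lemma three_codewords q (C : {set K3_vertex q}) (u : K3_vertex q) :
    self_locating_dominating (@K3_adj q) C -> u \notin C ->
  3 <= #|I_set (@K3_adj q) C u|.
Proof.
move=> /andP[_ /forallP/(_ u)/implyP locC] uC.
have /andP[I_neq0 /eqP capI] := locC uC.
rewrite ltnNge; apply/negP => I_le2.
have adjI c : c \in I_set (@K3_adj q) C u -> K3_adj u c.
  by rewrite !inE => /andP[/orP[/eqP->|//] cC]; rewrite cC in uC.
have [c1 [c2 [Ic1 Ic2 subI]]] : exists c1 c2, [/\ c1 \in I_set (@K3_adj q) C u,
    c2 \in I_set (@K3_adj q) C u & I_set (@K3_adj q) C u \subset [set c1; c2]].
  move: I_le2; rewrite leq_eqVlt ltnS => /orP[/cards2P[c1 [c2 [_ ->]]]|I_le1].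
    by exists c1, c2; rewrite set21 set22.
  have /cards1P[c ->] : #|I_set (@K3_adj q) C u| == 1.
    by rewrite eqn_leq I_le1 card_gt0.
  by exists c, c; rewrite set11 setUid.
have [w [w_neq w1 w2]] := common_neighbour (adjI _ Ic1) (adjI _ Ic2).
suff: w \in [set u] by rewrite inE (negPf w_neq).
rewrite -capI; apply/bigcapP => c /(subsetP subI).
by rewrite !inE => /orP[] /eqP->; move: w1 w2; rewrite !inE.
Qed.

Lemma SLD_lower_bound q (C : {set K3_vertex q}) :
  0 < q -> self_locating_dominating (@K3_adj q) C -> q ^ 2 <= #|C|.
Proof.
move=> q_gt0 codeC.
have := double_counting (@K3_adj_sym q)
  (fun u => three_codewords codeC) (fun c _ => K3_degree c).
rewrite -mulnA leq_pmul2l // !card_prod !card_ord leq_subLR.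
by rewrite -mulSn subn1 prednK // mulnC leq_pmul2l // mulnn.
Qed.

(** Suppose that v differs from u = (x, y, z), say in the first coordinate. Both
    (x, b, z) and (x, y, c) have first coordinate x, so v agrees with each of
    them in the other two; then its second coordinate is both b and y. *)
Lemma three_directions_locate q (x y z a b c : 'I_q) (v : K3_vertex q) :
    a != x -> b != y -> c != z ->
    v \in closed_nbh (@K3_adj q) (a, y, z) ->
    v \in closed_nbh (@K3_adj q) (x, b, z) ->
    v \in closed_nbh (@K3_adj q) (x, y, c) ->
  v = (x, y, z).
Proof.
case: v => [[x' y'] z'] nax nby ncz; rewrite !inE /= !xpair_eqE.
rewrite !(eq_sym x') !(eq_sym y') !(eq_sym z').
case: (eqVneq x x') => [<-|_]; case: (eqVneq y y') => [<-|_];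
  case: (eqVneq z z') => [<-|_] //=;
  rewrite ?(negPf nax) ?(negPf nby) ?(negPf ncz) //=;
  by do ?case: (_ == _).
Qed.

Section Plane.
Import GRing.Theory.
Local Open Scope ring_scope.
Variable n : nat.

Definition plane : {set K3_vertex n.+1} :=
  [set u : 'I_n.+1 * 'I_n.+1 * 'I_n.+1 | u.1.1 + u.1.2 + u.2 == 0].

Lemma card_plane : #|plane| = (n.+1 ^ 2)%N.
Proof.
have -> : plane = [set (p, - (p.1 + p.2)) | p : 'I_n.+1 * 'I_n.+1].
  apply/setP=> -[p z]; rewrite inE /= addrC addr_eq0.
  apply/eqP/imsetP => [->|[p' _ [-> ->]] //].
  by exists p.
by rewrite card_imset => [|p p' [] //]; rewrite card_prod card_ord mulnn.
Qed.

Lemma plane_SLD : self_locating_dominating (@K3_adj n.+1) plane.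
Proof.
apply/andP; split.
  by rewrite -card_gt0 card_plane expn_gt0.
apply/forallP=> -[[x y] z]; apply/implyP; rewrite inE /= => off.
(* the three codewords on the axis-parallel lines through (x, y, z) *)
pose a := - (y + z); pose b := - (x + z); pose c := - (x + y).
have nax : a != x.
  by apply: contraNneq off => <-; rewrite /a -addrA addNr.
have nby : b != y.
  by apply: contraNneq off => <-; rewrite addrAC /b subrr.
have ncz : c != z.
  by apply: contraNneq off => <-; rewrite /c subrr.
have I1 : (a, y, z) \in I_set (@K3_adj n.+1) plane (x, y, z).
  by rewrite !inE /= !eqxx (eq_sym x) (negPf nax) /= orbT -addrA addNr eqxx.
have I2 : (x, b, z) \in I_set (@K3_adj n.+1) plane (x, y, z).
  by rewrite !inE /= !eqxx (eq_sym y) (negPf nby) /= orbT addrAC subrr eqxx.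
have I3 : (x, y, c) \in I_set (@K3_adj n.+1) plane (x, y, z).
  by rewrite !inE /= !eqxx (eq_sym z) (negPf ncz) /= orbT subrr eqxx.
apply/andP; split; first by apply/set0Pn; exists (a, y, z).
rewrite eqEsubset; apply/andP; split; last first.
  rewrite sub1set; apply/bigcapP=> v; rewrite /I_set /closed_nbh !inE.
  by case/andP=> near _; rewrite eq_sym K3_adj_sym.
apply/subsetP=> v /bigcapP near; rewrite inE; apply/eqP.
exact: three_directions_locate nax nby ncz (near _ I1) (near _ I2) (near _ I3).
Qed.

End Plane.

Theorem corollary13 (q : nat) (hq : 1 <= q) :
  gamma_SLD (@K3_adj q) = q ^ 2.
Proof.
have V_gt0 : 0 < #|K3_vertex q| by rewrite !card_prod !card_ord !muln_gt0 hq.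
have [[C codeC cardC] minC] := gamma_SLDP (@K3_adj q) V_gt0.
apply/eqP; rewrite eqn_leq -{2}cardC SLD_lower_bound // andbT.
by case: q hq {V_gt0 C codeC cardC} minC => // n _ minC;
  rewrite -card_plane minC // plane_SLD.
Qed.
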